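(* Let $Z_n$ be the Zagreb index of the plain-oriented recursive tree $T_n$. As $n\to\infty$, the distribution of $Z_n$ is skewed to the right, i.e. its skewness $$\mathcal S(Z_n)=\mathbb{E}\left[\left(\frac{Z_n-\mathbb{E}[Z_n]}{\sqrt{\mathrm{Var}[Z_n]}}\right)^3\right]$$ satisfies $\liminf_{n\to\infty}\mathcal S(Z_n)>0$. Hence the asymptotic distribution is not normal: $(Z_n-\mathbb{E}[Z_n])/\sqrt{\mathrm{Var}[Z_n]}$ does not converge in distribution to a normal random variable.
   Context: The Zagreb index of a finite graph $G=(V,E)$ is $\sum_{v\in V}(\deg(v))^2$. The plain-oriented recursive tree $T_n$ is the random tree on nodes $\{1,\dots,n\}$ grown as follows: $T_1$ is the single node $1$, $T_2$ is the single edge joining nodes $1$ and $2$, and for $n\ge3$, given $T_{n-1}$, the new node $n$ is joined by an edge to one node $j$ of $T_{n-1}$ chosen with probability $\deg(j)/\sum_{u}\deg(u)=\deg(j)/(2(n-2))$, degrees being taken in $T_{n-1}$. $Z_n$ denotes the Zagreb index of $T_n$; it is non-deterministic for $n\ge 4$, so the skewness is considered for $n\ge4$. *)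

(* Defs.v *)
From HB Require Import structures.
From mathcomp Require Import all_boot all_order all_algebra.
From mathcomp Require Import all_classical all_reals all_analysis.
From mathcomp Require Import measurable_realfun.

Set Implicit Arguments.
Unset Strict Implicit.
Unset Printing Implicit Defensive.

Import Order.TTheory GRing.Theory Num.Theory.
Import numFieldNormedType.Exports.

Local Open Scope ring_scope.

Record sgraph (V : finType) := SGraph {
  edges : {set {set V}};
  _ : [forall e in edges, #|e| == 2%N] }.

HB.instance Definition _ (V : finType) := [isSub for @edges V].
HB.instance Definition _ (V : finType) := [Equality of sgraph V by <:].
HB.instance Definition _ (V : finType) := [Choice of sgraph V by <:].
HB.instance Definition _ (V : finType) := [Countable of sgraph V by <:].
HB.instance Definition _ (V : finType) := [Finite of sgraph V by <:].

Definition deg (V : finType) (G : sgraph V) (v : V) : nat :=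
  #|[set e in edges G | v \in e]|.

Definition zagreb (V : finType) (G : sgraph V) : nat :=
  (\sum_(v : V) deg G v ^ 2)%N.

Lemma edgeless_subproof (V : finType) :
  [forall e in (finset.set0 : {set {set V}}), #|e| == 2%N].
Proof. by apply/forall_inP => e; rewrite inE. Qed.

Definition edgeless (V : finType) : sgraph V := SGraph (edgeless_subproof V).

(* The nodes 1, ..., n are the elements 0, ..., n-1 of ['I_n]; the new node is *)
(* [ord_max : 'I_n.+1], and [widen_ord] embeds the old nodes.                 *)
Definition attach_edges (n : nat) (G : sgraph 'I_n) (j : 'I_n) :
    {set {set 'I_n.+1}} :=
  let w := widen_ord (leqnSn n) in
  ([set ord_max; w j] |: [set w @: (e : {set 'I_n}) | e in edges G])%SET.

Lemma attach_subproof (n : nat) (G : sgraph 'I_n) (j : 'I_n) :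
  [forall e in attach_edges G j, #|e| == 2%N].
Proof.
apply/forall_inP => e /setU1P[->|/imsetP[f fG ->]].
  by rewrite cards2 -val_eqE /= (gtn_eqF (ltn_ord j)).
rewrite card_imset; last by move=> x y /(congr1 val)/= /val_inj.
exact: (forall_inP (valP G)).
Qed.

Definition attach (n : nat) (G : sgraph 'I_n) (j : 'I_n) : sgraph 'I_n.+1 :=
  SGraph (attach_subproof G j).

(* Random graphs are random variables for the discrete sigma-algebra. *)
HB.instance Definition _ (V : finType) := isPointed.Build (sgraph V) (edgeless V).
HB.instance Definition _ (V : finType) :=
  @isMeasurable.Build default_measure_display (sgraph V)
    (@discrete_measurable (sgraph V))
    (@discrete_measurable0 _) (@discrete_measurableC _)
    (@discrete_measurableU _).


(* The conditional probability that [T n.+1] is [G] plus a new node joined to *)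
(* [j], given [T n = G], is deg(j) / (sum of degrees of G); multiplied by     *)
(* [P(T n = G)], so that graphs [G] of probability 0 are unconstrained.       *)
(* [T 0] plays no role.                                                       *)
Definition plain_oriented_recursive_tree d (Omega : measurableType d)
    (R : realType) (P : probability Omega R)
    (T : forall n : nat, {RV P >-> sgraph 'I_n}) : Prop :=
  [/\ P (T 1%N @^-1` [set edgeless 'I_1])%classic = 1%E,
      P (T 2%N @^-1` [set attach (edgeless 'I_1) ord0])%classic = 1%E &
      forall (n : nat) (G : sgraph 'I_n) (j : 'I_n), (2 <= n)%N ->
        P (T n @^-1` [set G] `&` T n.+1 @^-1` [set attach G j])%classic =
        (P (T n @^-1` [set G])%classic *
          ((deg G j)%:R / (\sum_(u < n) deg G u)%N%:R)%:E)%E].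
Arguments plain_oriented_recursive_tree {d Omega R} P T.

Section random_variables.
Context d (Omega : measurableType d) (R : realType) (P : probability Omega R).

Definition zagreb_rv (n : nat) (T : {RV P >-> sgraph 'I_n}) (w : Omega) : R :=
  (zagreb (T w))%:R.

Lemma measurable_zagreb_rv (n : nat) (T : {RV P >-> sgraph 'I_n}) :
  measurable_fun [set: Omega] (zagreb_rv T).
Proof.
apply: (@measurableT_comp _ _ _ _ _ _ (fun G : sgraph 'I_n => (zagreb G)%:R : R)).
  by [].
exact: measurable_funPT.
Qed.

HB.instance Definition _ (n : nat) (T : {RV P >-> sgraph 'I_n}) :=
  isMeasurableFun.Build _ _ _ _ (zagreb_rv T) (measurable_zagreb_rv T).

Definition standardize (X : {RV P >-> R}) (w : Omega) : R :=
  (X w - fine 'E_P[X]) / Num.sqrt (fine 'V_P[X]).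

Lemma measurable_standardize (X : {RV P >-> R}) :
  measurable_fun [set: Omega] (standardize X).
Proof.
by apply: measurable_funM => //; apply: measurable_funB.
Qed.

HB.instance Definition _ (X : {RV P >-> R}) :=
  isMeasurableFun.Build _ _ _ _ (standardize X) (measurable_standardize X).

Definition skewness (X : {RV P >-> R}) : \bar R :=
  'E_P[(fun w => standardize X w ^+ 3)].

(* [X n] and the limit [Y] may live on different probability spaces. *)
Definition cvg_in_distribution d' (Omega' : measurableType d')
    (P' : probability Omega' R) (X : nat -> {RV P >-> R}) (Y : {RV P' >-> R}) :
    Prop :=
  forall x : R, {for x, continuous (cdf Y)} ->
    (cdf (X n) x @[n --> \oo] --> cdf Y x)%classic.

End random_variables.

Arguments zagreb_rv {d Omega R} P {n} T w.
Arguments standardize {d Omega R} P X w.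
Arguments skewness {d Omega R} P X.
Arguments cvg_in_distribution {d Omega R} P {d' Omega'} P' X Y.

(* [normal_prob m s] is a normal law only for [s != 0]. *)
Definition normal_rv d (Omega : measurableType d) (R : realType)
    (P : probability Omega R) (Y : {RV P >-> R}) : Prop :=
  exists m s : R, 0 < s /\
    forall A : set R, measurable A -> distribution P Y A = normal_prob m s A.

Arguments normal_rv {d Omega R} P Y.

(* Main.v *)
Require Import Defs.
From mathcomp Require Import all_boot all_order all_algebra.
From mathcomp Require Import all_classical all_reals all_analysis.
From mathcomp Require Import measurable_realfun.
From mathcomp Require Import ring lra.

(* Let X be the sum of d(d+1) over the degrees d of the tree with N edges.    *)
(* Then X = Z + 2N, and the rising moments of the degrees satisfy closed      *)
(* linear recursions; in particular X/N minus its mean is a martingale. The   *)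
(* third central moment of X divided by N(N+1)(N+2) increases with N: its     *)
(* increments combine the third central moment of one jump with               *)
(* Cov(X, S) - Var(X) (1 + E X / N), where S is the sum of d(d+1)(d+2), and   *)
(* both are nonnegative. As Var(X) = O(N^2), the skewness stays bounded below.*)
(*                                                                            *)
(* For the failure of normality, the tree is a star with m edges with         *)
(* probability 2^(1-m). Restarting the recursions from that star raises the   *)
(* mean of X/N by about m, with a variance only O(m), so for all large n the  *)
(* standardized index exceeds a multiple of m with probability at least       *)
(* 2^(-m-1): the upper tail is too heavy for a normal law.                    *)

Import Order.TTheory GRing.Theory Num.Theory.
Import numFieldNormedType.Exports.

Local Open Scope ring_scope.

(** Attaching proportionally to degree raises the order of a rising factorial of the degree by one,
    so [rise2], [rise3], [rise4] form a closed system and the central moments of [rise2] obey exact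
    recursions ([var_rise2S], [cov_rise23S], [third_rise2S]), solved by [var2], [cov23], [third2].
    By the handshake identity [zagreb] and [rise2] differ by a constant on trees of a given size,
    hence [skewness_zagreb]. Since [cov_excess_ge0] and [jump3_ge0] make the inhomogeneous terms of
    the third-moment recursion nonnegative, [third2] is at least of order N^3 for N edges
    ([third2_lower]), while [var_rise2_upper] bounds the variance by order N^2.

    A positive lower limit of the skewness does not by itself exclude a normal limit, because
    convergence in distribution does not carry third moments along; tails are compared instead.
    [standardize_zagreb_tail] gives, uniformly in n, probability at least 2^(-m) of exceeding m/70.
    This survives the limit, whereas a normal law leaves only O(exp(-2m)) above m/100
    ([normal_prob_upper_tail]); [not_exp_dominated] concludes. *)

(** * Real sequences of moments and their signs *)

Section MomentRecursions.
Context {R : realFieldType}.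
Implicit Types k : nat.

(* [k] indexes the tree with [k.+1] edges. [mean2] and [mean3] are the means  *)
(* of the sums of d(d+1) and d(d+1)(d+2) over the degrees d, divided by the   *)
(* number of edges; [var2] and [third2] are the central moments of the first  *)
(* sum, [cov23] its covariance with the second, [jump3] the third central     *)
(* moment of its increment and [jump_var] half the variance of that.          *)
Fixpoint mean2 k : R := if k is i.+1 then mean2 i + 2 / i.+2%:R else 4.

Fixpoint mean3 k : R :=
  if k is i.+1 then mean3 i + (mean3 i / 2 + 6) / i.+2%:R else 12.

Fixpoint var2 k : R :=
  if k is i.+1 then
    var2 i * (1 + 2 / i.+1%:R) + 2 * (mean3 i - mean2 i) - mean2 i ^+ 2
  else 0.

Fixpoint cov23 k : R :=
  if k is i.+1 then
    cov23 i * (1 + 5 / (2 * i.+1%:R)) + 3 * (36 * i.+1%:R + 12 - 2 * mean3 i)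
    - 3 / 2 * mean2 i * mean3 i
  else 0.

Definition jump3 k : R :=
  144 * k.+1%:R + 48 - 12 * mean3 k + 4 * mean2 k - 6 * mean2 k * mean3 k
  + 6 * mean2 k ^+ 2 + 2 * mean2 k ^+ 3.

Fixpoint third2 k : R :=
  if k is i.+1 then
    third2 i * (1 + 3 / i.+1%:R)
    + 6 * (cov23 i - var2 i * (1 + mean2 i)) / i.+1%:R + jump3 i
  else 0.

Lemma natS_ge1 k : 1 <= k.+1%:R :> R.
Proof. by rewrite ler1n. Qed.

Lemma natSS k : k.+2%:R = k.+1%:R + 1 :> R.
Proof. by rewrite [RHS]natr1. Qed.

Lemma mean2S k : mean2 k.+1 = mean2 k + 2 / (k.+1%:R + 1).
Proof. by rewrite -natSS. Qed.

Lemma mean3S k : mean3 k.+1 = mean3 k + (mean3 k / 2 + 6) / (k.+1%:R + 1).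
Proof. by rewrite -natSS. Qed.

Lemma var2S k : var2 k.+1 =
  var2 k * (1 + 2 / k.+1%:R) + 2 * (mean3 k - mean2 k) - mean2 k ^+ 2.
Proof. by []. Qed.

Lemma cov23S k : cov23 k.+1 =
  cov23 k * (1 + 5 / (2 * k.+1%:R)) + 3 * (36 * k.+1%:R + 12 - 2 * mean3 k)
  - 3 / 2 * mean2 k * mean3 k.
Proof. by []. Qed.

Lemma third2S k : third2 k.+1 = third2 k * (1 + 3 / k.+1%:R)
  + 6 * (cov23 k - var2 k * (1 + mean2 k)) / k.+1%:R + jump3 k.
Proof. by []. Qed.

Definition jump_var k : R := mean3 k - mean2 k - mean2 k ^+ 2 / 2.

Lemma mean2_ge4 k : 4 <= mean2 k.
Proof.
elim: k => [|k IH] //; rewrite mean2S.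
have : 0 <= 2 / (k.+1%:R + 1) :> R by rewrite divr_ge0 // addr_ge0.
by move: (_ / _) => y; lra.
Qed.

Lemma mean2_ge5 k : 5 <= mean2 k.+1.
Proof.
elim: k => [|k IH]; first by rewrite /=; lra.
rewrite mean2S.
have : 0 <= 2 / (k.+2%:R + 1) :> R by rewrite divr_ge0 // addr_ge0.
by move: (_ / _) => y; lra.
Qed.

(** Beyond a positive multiple of the previous value, each step adds a term that completes to a
    square plus a positive rest. *)
Lemma jump_var_ge0 k : 0 <= jump_var k.
Proof.
rewrite /jump_var; elim: k => [|k IH]; first by rewrite /=; lra.
rewrite mean2S mean3S.
have := natS_ge1 k; move: (k.+1%:R) => x x1.
set s := (x + 1)^-1.
have s0 : 0 < s by rewrite invr_gt0; lra.
have s1 : s <= 1 / 2 by rewrite /s -div1r ler_pdivrMr; lra.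
move: IH; have := mean2_ge4 k; set A := mean2 k; set B := mean3 k => A4 IH.
have -> : B + (B / 2 + 6) * s - (A + 2 * s) - (A + 2 * s) ^+ 2 / 2 =
  (B - A - A ^+ 2 / 2) * (1 + s / 2)
   + s * (A ^+ 2 / 4 - 3 / 2 * A + 9 / 4 + 3 / 4 + (1 - 2 * s)) by field.
apply: addr_ge0; first by apply: mulr_ge0; lra.
apply: mulr_ge0; first lra.
suff : 0 <= (A / 2 - 3 / 2) ^+ 2 by rewrite sqrrB; lra.
exact: sqr_ge0.
Qed.

(** The factor split off in [jump3S] is the homogeneous growth factor of [mean3], so that the
    awkward product [mean2 k * mean3 k] cancels and only a linear term has to dominate. *)
Definition jump_defect k : R :=
  72 * k.+1%:R + 56 - 12 * mean3 k - 14 * mean2 k + 9 * mean2 k ^+ 2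
  - mean2 k ^+ 3
  + (24 * mean2 k - 6 * mean3 k - 48) / k.+2%:R + 16 / k.+2%:R ^+ 2.

Lemma jump3S k : jump3 k.+1 =
  jump3 k * (1 + (2 * k.+2%:R)^-1) + jump_defect k / k.+2%:R.
Proof.
rewrite /jump3 /jump_defect mean2S mean3S (natSS k).
have := natS_ge1 k; move: (k.+1%:R) => x x1; field; lra.
Qed.

(* [mean2] grows like log k and [mean3] like k^(1/2), so linear bounds with   *)
(* ample slopes hold as soon as they hold at 5 edges.                         *)
Lemma mean_linear_bounds k : [/\ mean2 (4 + k) <= (4 + k).+1%:R / 2 + 21 / 5,
  mean3 (4 + k) <= 37 / 10 * (4 + k).+1%:R + 13,
  6 * mean2 (4 + k) ^+ 2 - 36 * mean2 (4 + k) + 28 <= 20 * (4 + k).+1%:R - 30 &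
  mean2 (4 + k) ^+ 3 - 9 * mean2 (4 + k) ^+ 2 + 14 * mean2 (4 + k)
    <= 20 * (4 + k).+1%:R - 112].
Proof.
elim: k => [|k]; first by rewrite addn0 /=; split; lra.
rewrite addnS; set m := (4 + k)%N => -[IHA IHB IHp IHh].
rewrite mean2S mean3S (natSS m).
have x5 : 5 <= m.+1%:R :> R by rewrite ler_nat /m.
move: IHA IHB IHp IHh; have := mean2_ge4 m.
move: (mean2 m) (mean3 m) (m.+1%:R) x5 => A B x x5.
move=> A4 IHA IHB IHp IHh.
set s := (x + 1)^-1.
have sx : s * (x + 1) = 1 by rewrite mulVf //; lra.
have s0 : 0 < s by rewrite invr_gt0; lra.
have s1 : s <= 1 / 6 by rewrite /s -div1r ler_pdivrMr; lra.
have le_s u c : u <= c * (x + 1) -> u * s <= c.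
  by move=> h; rewrite -[s]div1r mulrA mulr1 ler_pdivrMr //; lra.
split.
- lra.
- have : (B / 2 + 6) * s <= 37 / 10 by apply: le_s; lra.
  lra.
- have : (24 * A - 72 + 24 * s) * s <= 20 by apply: le_s; lra.
  have -> : 6 * (A + 2 * s) ^+ 2 - 36 * (A + 2 * s) + 28 =
    6 * A ^+ 2 - 36 * A + 28 + (24 * A - 72 + 24 * s) * s by ring.
  lra.
- have sA : (12 * A - 36) * s <= 8 by apply: le_s; lra.
  have ss : 8 * s ^+ 2 <= 1.
    have : s ^+ 2 <= (1 / 6) ^+ 2 by rewrite ler_sqr ?nnegrE; lra.
    lra.
  have : (6 * A ^+ 2 - 36 * A + 28 + (12 * A - 36) * s + 8 * s ^+ 2) * s <= 20.
    by apply: le_s; lra.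
  have -> : (A + 2 * s) ^+ 3 - 9 * (A + 2 * s) ^+ 2 + 14 * (A + 2 * s) =
    A ^+ 3 - 9 * A ^+ 2 + 14 * A
    + (6 * A ^+ 2 - 36 * A + 28 + (12 * A - 36) * s + 8 * s ^+ 2) * s by ring.
  lra.
Qed.

Lemma jump_defect_ge0 k : 0 <= jump_defect (4 + k).
Proof.
have [_ hB _ hh] := mean_linear_bounds k.
rewrite /jump_defect; set m := (4 + k)%N in hB hh *.
have x5 : 5 <= m.+1%:R :> R by rewrite ler_nat /m.
move: hB hh; have := mean2_ge4 m.
rewrite (natSS m); move: (mean2 m) (mean3 m) (m.+1%:R) x5 => A B x x5.
move=> A4 hB hh.
set s := (x + 1)^-1.
have sx : s * (x + 1) = 1 by rewrite mulVf //; lra.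
have s0 : 0 < s by rewrite invr_gt0; lra.
have : 0 <= 16 / (x + 1) ^+ 2 by rewrite divr_ge0 ?exprn_ge0; lra.
have : (6 * B) * s <= 35.
  by rewrite -[s]div1r mulrA mulr1 ler_pdivrMr; lra.
have : 0 <= s * (24 * A - 48) by apply: mulr_ge0; lra.
lra.
Qed.

Lemma jump3_ge0 k : 0 <= jump3 k.
Proof.
(* [jump3 0] and [jump3 1] are exactly zero (the jump is constant, then symmetric), so the small
   cases leave no room for estimates. *)
have small i : (i <= 4)%N -> 0 <= jump3 i.
  by case: i => [|[|[|[|[|i]]]]] // _; rewrite /jump3 /=; lra.
have [/small//|/ltnW k4] := leqP k 4.
rewrite -(subnKC k4); elim: (k - 4)%N => [|i IH]; first exact: small.
rewrite addnS jump3S; apply: addr_ge0.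
  by rewrite mulr_ge0 // addr_ge0 // invr_ge0 mulr_ge0.
by rewrite divr_ge0 // jump_defect_ge0.
Qed.

Lemma var2_ge0 k : 0 <= var2 k.
Proof.
elim: k => [|k IH] //; rewrite var2S; have := jump_var_ge0 k; rewrite /jump_var.
have : 0 <= var2 k * (1 + 2 / k.+1%:R).
  by rewrite mulr_ge0 // addr_ge0 // divr_ge0.
by move: (var2 k * _) => u; lra.
Qed.

Definition cov_excess k : R := cov23 k - var2 k * (1 + mean2 k).

(** Written so that every summand is a nonnegative quantity times a coefficient whose sign can be
    read off. *)
Lemma cov_excessS k : cov_excess k.+1 =
  cov_excess k * (1 + 5 / (2 * k.+1%:R))
  + var2 k * ((1 + mean2 k) / (2 * k.+1%:R)
              - 2 * (k.+1%:R + 2) / (k.+1%:R * k.+2%:R))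
  + 3 / 4 * jump3 k + (1 + mean2 k - 4 / k.+2%:R) * jump_var k.
Proof.
rewrite /cov_excess /jump3 /jump_var cov23S var2S mean2S (natSS k).
have := natS_ge1 k; move: (k.+1%:R) => x x1; field.
by apply/andP; split; lra.
Qed.

Lemma cov_excess_ge0 k : 0 <= cov_excess k.
Proof.
elim: k => [|k IH]; first by rewrite /cov_excess /=; lra.
have x1 := natS_ge1 k; have A4 := mean2_ge4 k.
rewrite cov_excessS; apply: addr_ge0; last first.
  apply: mulr_ge0 (jump_var_ge0 k).
  have : 4 / k.+2%:R <= 4 :> R by rewrite ler_pdivrMr // (natSS k); lra.
  by move: (4 / _) => u; lra.
apply: addr_ge0; last by have := jump3_ge0 k; lra.
apply: addr_ge0; first by rewrite mulr_ge0 // addr_ge0 // divr_ge0 // mulr_ge0.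
(* The coefficient of [var2] is negative at one edge, where [var2] vanishes; from two edges on
   [mean2] is at least 5, which suffices. *)
case: k IH x1 A4 => [|k] _ x1 _; first by rewrite /= mul0r.
have A5 := mean2_ge5 k.
apply: mulr_ge0 (var2_ge0 _) _; rewrite subr_ge0 (natSS k.+1).
move: (mean2 k.+1) A5 (k.+2%:R) x1 => A A5 x x1.
have -> : 2 * (x + 2) / (x * (x + 1)) = (4 * (x + 2) / (x + 1)) / (2 * x).
  by field; apply/andP; split; lra.
rewrite ler_pM2r ?invr_gt0; last lra.
rewrite ler_pdivrMr; last lra.
have : 0 <= (A - 5) * (x + 1) by apply: mulr_ge0; lra.
lra.
Qed.

(** For N edges the factor 1 + 3/N carries N(N+1)(N+2) to (N+1)(N+2)(N+3), so this denominator
    absorbs the homogeneous part of the recursion. *)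
Definition normalized_third k : R :=
  third2 k / (k.+1%:R * (k.+1%:R + 1) * (k.+1%:R + 2)).

Lemma third2S_ge k : third2 k * (1 + 3 / k.+1%:R) + jump3 k <= third2 k.+1.
Proof.
rewrite third2S lerD2r lerDl divr_ge0 // mulr_ge0 //.
exact: cov_excess_ge0.
Qed.

Lemma normalized_thirdS_ge k : normalized_third k <= normalized_third k.+1.
Proof.
have x1 := natS_ge1 k.
rewrite /normalized_third (natSS k); set x := k.+1%:R in x1 *.
rewrite ler_pdivlMr; last by rewrite !mulr_gt0; lra.
apply: le_trans (third2S_ge k).
have -> : third2 k / (x * (x + 1) * (x + 2)) * ((x + 1) * (x + 1 + 1) * (x + 1 + 2)) =
  third2 k * (1 + 3 / x) by field; apply/and3P; split; lra.
by rewrite lerDl jump3_ge0.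
Qed.

(** Index 3 is the first possible: with three edges the tree is a star or a path with probability
    1/2 each, so [third2 2] is still zero. *)
Lemma normalized_third3_gt0 : 0 < normalized_third 3.
Proof.
have third_ge0 k : 0 <= third2 k.
  elim: k => [|k IH] //; apply: le_trans (third2S_ge k).
  by rewrite addr_ge0 ?jump3_ge0 // mulr_ge0 // addr_ge0 // divr_ge0.
have jump2 : 0 < jump3 2 by rewrite /jump3 /=; lra.
apply: divr_gt0; last by rewrite !mulr_gt0 // addr_gt0.
apply: lt_le_trans (third2S_ge 2).
by rewrite ltr_wpDl // mulr_ge0 // addr_ge0 // divr_ge0.
Qed.

Lemma third2_lower k : (3 <= k)%N -> normalized_third 3 * k.+1%:R ^+ 3 <= third2 k.
Proof.
move=> k3; have tau0 := normalized_third3_gt0.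
have x1 := natS_ge1 k.
have le_k : normalized_third 3 <= normalized_third k.
  rewrite -(subnKC k3); elim: (k - 3)%N => [|i IH] //.
  by rewrite addnS (le_trans IH) ?normalized_thirdS_ge.
rewrite {2}/normalized_third in le_k; move: (k.+1%:R) x1 le_k => x x1.
rewrite ler_pdivlMr; last by rewrite !mulr_gt0; lra.
apply: le_trans; rewrite ler_pM2l //.
rewrite !exprS expr0 mulr1 mulrA; apply: ler_pM; last lra.
- by rewrite mulr_ge0; lra.
- lra.
- by rewrite ler_wpM2l; lra.
Qed.

End MomentRecursions.

(** * Degrees after attaching a node *)

Lemma deg_sum (V : finType) (G : sgraph V) v :
  deg G v = (\sum_(e in edges G) (v \in e))%N.
Proof.
rewrite /deg -sum1_card big_mkcond [RHS]big_mkcond /=.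
by apply: eq_bigr => e _; rewrite inE; case: (e \in edges G); case: (v \in e).
Qed.

Section AttachDegrees.
Context {n : nat} (G : sgraph 'I_n) (j : 'I_n).
Let w := widen_ord (leqnSn n).

Let w_inj : injective w.
Proof. by move=> x y /(congr1 val)/= /val_inj. Qed.

Let w_max i : (w i == ord_max) = false.
Proof. by apply/negbTE; rewrite -val_eqE /= neq_ltn ltn_ord. Qed.

Let max_notin (e : {set 'I_n}) : (ord_max \in w @: e) = false.
Proof.
by apply/negbTE/imsetP => -[i _ /esym/eqP]; rewrite w_max.
Qed.

Let deg_attach_sum v : deg (attach G j) v =
  ((v \in [set ord_max; w j]) + \sum_(e in edges G) (v \in w @: e))%N.
Proof.
rewrite deg_sum /= big_setU1 /=; last first.
  apply/imsetP => -[e _ /setP/(_ ord_max)].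
  by rewrite max_notin !inE eqxx.
by rewrite big_imset //= => e f _ _; apply: imset_inj.
Qed.

Lemma deg_attach_max : deg (attach G j) ord_max = 1%N.
Proof.
rewrite deg_attach_sum !inE eqxx big1 // => e _.
by rewrite max_notin.
Qed.

Lemma deg_attach_widen i :
  deg (attach G j) (widen_ord (leqnSn n) i) = (deg G i + (i == j))%N.
Proof.
rewrite deg_attach_sum !inE w_max (inj_eq w_inj) addnC deg_sum.
by congr (_ + _)%N; apply: eq_bigr => e _; rewrite mem_imset.
Qed.

Lemma sum_deg_attach (A : pzRingType) (g : nat -> A) :
  \sum_v g (deg (attach G j) v) =
  \sum_v g (deg G v) + (g (deg G j).+1 - g (deg G j)) + g 1%N.
Proof.
rewrite big_ord_recr deg_attach_max /=; congr (_ + _).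
under eq_bigr do rewrite deg_attach_widen.
rewrite (bigD1 j) //= [\sum_v g (deg G v)](bigD1 j) //= eqxx addn1.
rewrite (eq_bigr (fun i => g (deg G i))) => [|i /negbTE ->].
  by rewrite [RHS]addrC addrA subrK.
by rewrite addn0.
Qed.

End AttachDegrees.

(** The degree of [i] tells whether [i] is the parent; hence a transition to a given tree has a
    single term. *)
Lemma attach_inj {n} (G : sgraph 'I_n) : injective (attach G).
Proof.
move=> i j /(congr1 (fun H => deg H (widen_ord (leqnSn n) i))).
rewrite !deg_attach_widen eqxx => /addnI/esym/eqP.
by rewrite eqb1 => /eqP.
Qed.

Fixpoint star k : sgraph 'I_k.+2 :=
  if k is i.+1 then attach (star i) ord0 else attach (edgeless 'I_1) ord0.

(** * The Markov chain of trees, started from a star *)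

Section GrowthLaw.
Context {R : realFieldType}.

Definition mean {n} (mu : sgraph 'I_n -> R) (f : sgraph 'I_n -> R) : R :=
  \sum_G mu G * f G.

Definition growth_step {n} (f : sgraph 'I_n.+1 -> R) (G : sgraph 'I_n) : R :=
  \sum_j (deg G j)%:R / (\sum_u deg G u)%:R * f (attach G j).

Lemma meanD n (mu f g : sgraph 'I_n -> R) :
  mean mu (fun G => f G + g G) = mean mu f + mean mu g.
Proof. by rewrite -big_split; apply: eq_bigr => G _; rewrite mulrDr. Qed.

Lemma meanZ n (mu f : sgraph 'I_n -> R) c :
  mean mu (fun G => c * f G) = c * mean mu f.
Proof. by rewrite mulr_sumr; apply: eq_bigr => G _; rewrite mulrCA. Qed.

Lemma eq_mean n (mu f g : sgraph 'I_n -> R) :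
  (forall G, mu G != 0 -> f G = g G) -> mean mu f = mean mu g.
Proof.
move=> fg; apply: eq_bigr => G _.
by have [->|/fg ->] := eqVneq (mu G) 0; rewrite ?mul0r.
Qed.

Lemma le_mean n (mu f g : sgraph 'I_n -> R) : (forall G, 0 <= mu G) ->
  (forall G, mu G != 0 -> f G <= g G) -> mean mu f <= mean mu g.
Proof.
move=> mu0 fg; apply: ler_sum => G _.
by have [->|/fg ?] := eqVneq (mu G) 0; rewrite ?mul0r // ler_wpM2l.
Qed.

Lemma mean_dirac n (H : sgraph 'I_n) (f : sgraph 'I_n -> R) :
  mean (fun G => (G == H)%:R) f = f H.
Proof.
rewrite /mean (bigD1 H) //= eqxx mul1r big1 ?addr0 // => G /negbTE ->.
by rewrite mul0r.
Qed.

Lemma mean_eq n (mu : sgraph 'I_n -> R) (H : sgraph 'I_n) :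
  mean mu (fun G => (G == H)%:R) = mu H.
Proof.
rewrite -[RHS](mean_dirac _ H mu); apply: eq_bigr => G _.
by rewrite mulrC.
Qed.

Lemma growth_step_ge0 n (f : sgraph 'I_n.+1 -> R) G :
  (forall H, 0 <= f H) -> 0 <= growth_step f G.
Proof. by move=> f0; apply: sumr_ge0 => j _; rewrite mulr_ge0 // divr_ge0. Qed.

(* The law of [T k.+2] for the tree grown from [star k0]; it is only          *)
(* meaningful for [k0 <= k], the values below [k0] being a convenience.       *)
Fixpoint grown_law (k0 k : nat) : sgraph 'I_k.+2 -> R :=
  if k is i.+1 return sgraph 'I_k.+2 -> R then
    if (k <= k0)%N then fun G => (G == star i.+1)%:R
    else fun G => mean (grown_law k0 i) (growth_step (fun H => (H == G)%:R))
  else fun G => (G == star 0)%:R.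

Lemma grown_law_start k0 G : grown_law k0 k0 G = (G == star k0)%:R.
Proof. by case: k0 G => [|k] G //=; rewrite leqnn. Qed.

Lemma mean_start k0 f : mean (grown_law k0 k0) f = f (star k0).
Proof.
rewrite -[RHS]mean_dirac; apply: eq_bigr => G _.
by rewrite grown_law_start.
Qed.

(** The tower property: [growth_step f] is the conditional expectation of [f] one step later. *)
Lemma mean_grown_law k0 k f : (k0 <= k)%N ->
  mean (grown_law k0 k.+1) f = mean (grown_law k0 k) (growth_step f).
Proof.
move=> k0k; rewrite {1}/mean /= ltnNge k0k /=.
under eq_bigr do rewrite mulr_suml.
rewrite exchange_big; apply: eq_bigr => G _ /=.
under eq_bigr do rewrite -mulrA.
rewrite -mulr_sumr; congr (_ * _).
under eq_bigr do rewrite mulr_suml.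
rewrite exchange_big; apply: eq_bigr => j _ /=.
under eq_bigr do rewrite -!mulrA.
rewrite -!mulr_sumr mulrA; congr (_ * _).
rewrite -[RHS](mean_dirac _ (attach G j)); apply: eq_bigr => H _.
by rewrite eq_sym.
Qed.

Lemma grown_law_ge0 k0 k G : 0 <= grown_law k0 k G.
Proof.
elim: k G => [|k IH] G //=; case: ifP => // _.
by apply: sumr_ge0 => H _; rewrite mulr_ge0 // growth_step_ge0.
Qed.

Lemma sum_deg_attachE n (G : sgraph 'I_n) j :
  \sum_u (deg (attach G j) u)%:R = \sum_u (deg G u)%:R + 2 :> R.
Proof. by rewrite (sum_deg_attach _ _ _ (fun i => i%:R)) -natr1; ring. Qed.

Lemma deg_edge (j : 'I_2) : deg (star 0) j = 1%N.
Proof.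
have deg0 i : deg (edgeless 'I_1) i = 0%N.
  by apply/eqP; rewrite cards_eq0; apply/eqP/setP => e; rewrite !inE.
have [i ->|->] := unliftP ord_max j; last exact: deg_attach_max.
have -> : lift ord_max i = widen_ord (leqnSn 1) i.
  by apply: val_inj; rewrite /= /bump leqNgt ltn_ord.
by rewrite deg_attach_widen deg0 !ord1 eqxx.
Qed.

Lemma deg_star0 k : deg (star k) ord0 = k.+1.
Proof.
elim: k => [|k IH]; first exact: deg_edge.
have -> : ord0 = widen_ord (leqnSn k.+2) ord0 by exact: val_inj.
by rewrite [star _]/= deg_attach_widen IH eqxx addn1.
Qed.

Lemma sum_deg_starE k (g : nat -> R) :
  \sum_u g (deg (star k) u) = g k.+1 + k.+1%:R * g 1%N.
Proof.
elim: k => [|k IH].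
  by rewrite !big_ord_recr big_ord0 /= !deg_edge; ring.
by rewrite [star _]/= sum_deg_attach IH deg_star0 -(natr1 k.+1); ring.
Qed.

Lemma sum_deg_grown_law k0 k G : (k0 <= k)%N -> grown_law k0 k G != 0 ->
  (\sum_u deg G u)%:R = 2 * k.+1%:R :> R.
Proof.
move=> k0k; rewrite natr_sum; elim: k k0k G => [|k IH].
  rewrite leqn0 => /eqP -> G; rewrite pnatr_eq0 eqb0 negbK => /eqP ->.
  by rewrite (sum_deg_starE 0 (fun i => i%:R)); ring.
rewrite leq_eqVlt ltnS => /predU1P[->|k0k] G.
  rewrite grown_law_start pnatr_eq0 eqb0 negbK => /eqP ->.
  by rewrite (sum_deg_starE _ (fun i => i%:R)); ring.
rewrite -mean_eq mean_grown_law //; apply: contraNeq => dG.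
rewrite /mean big1 // => H _.
have [->|/(IH k0k) dH] := eqVneq (grown_law k0 k H) 0; first by rewrite mul0r.
rewrite /growth_step big1 ?mulr0 // => j _.
have [HG|_] := eqVneq; last by rewrite mulr0.
by rewrite -HG sum_deg_attachE dH -(natr1 k.+1) mulrDr mulr1 eqxx in dG.
Qed.

Lemma mean_grown_law1 k0 k : (k0 <= k)%N ->
  mean (grown_law k0 k) (fun=> 1) = 1.
Proof.
elim: k => [|k IH]; first by rewrite leqn0 => /eqP ->; rewrite mean_start.
rewrite leq_eqVlt ltnS => /predU1P[->|k0k]; first by rewrite mean_start.
rewrite mean_grown_law // -[RHS](IH k0k).
apply: eq_mean => G /(sum_deg_grown_law _ _ _ k0k) dG.
rewrite /growth_step /=; under eq_bigr do rewrite mulr1.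
by rewrite -mulr_suml -natr_sum divff // dG mulf_neq0 ?pnatr_eq0.
Qed.

(** The centre of a star carries half of the total degree, so each step keeps the star with
    probability at least 1/2. *)
Lemma grown_law_star_ge k : 2 ^- k <= grown_law 0 k (star k).
Proof.
elim: k => [|k IH]; first by rewrite /= eqxx expr0 invr1.
rewrite -(mean_eq _ (grown_law 0 k.+1)) mean_grown_law // /mean.
rewrite (bigD1 (star k)) //= ler_wpDr //.
  by rewrite sumr_ge0 // => G _; rewrite mulr_ge0 ?grown_law_ge0 ?growth_step_ge0.
rewrite exprSr invfM ler_pM ?invr_ge0 ?exprn_ge0 //.
rewrite /growth_step (bigD1 ord0) //= ler_wpDr //.
  by rewrite sumr_ge0 // => j _; rewrite mulr_ge0 ?divr_ge0.
rewrite eqxx mulr1 deg_star0 natr_sum (sum_deg_starE _ (fun i => i%:R)).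
have -> : k.+1%:R + k.+1%:R * 1 = 2 * k.+1%:R :> R by ring.
by rewrite invfM mulrCA divff ?mulr1 ?pnatr_eq0.
Qed.

(** Passing through [star k0] is one way of reaching [G]; the bound propagates because the growth
    step is linear and positive. *)
Lemma grown_law_star_lower k0 k G : (k0 <= k)%N ->
  2 ^- k0 * grown_law k0 k G <= grown_law 0 k G.
Proof.
elim: k G => [|k IH] G.
  by rewrite leqn0 => /eqP ->; rewrite expr0 invr1 mul1r.
rewrite leq_eqVlt ltnS => /predU1P[->|k0k].
  rewrite grown_law_start; have [->|_] := eqVneq.
    by rewrite mulr1 grown_law_star_ge.
  by rewrite mulr0 grown_law_ge0.
rewrite -[in leLHS]mean_eq -[leRHS]mean_eq !mean_grown_law // mulr_sumr.
apply: ler_sum => H _; rewrite mulrA ler_wpM2r ?IH //.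
exact: growth_step_ge0.
Qed.

End GrowthLaw.

(** * One-step recursions for the moments of rising sums *)

Section Moments.
Context {R : realFieldType}.

(** A fixed shape for linearity, so that moment identities reduce to [field]; shorter combinations
    are padded with zero coefficients. *)
Lemma mean_comb n (mu f1 f2 f3 f4 f5 f6 : sgraph 'I_n -> R) a0 a1 a2 a3 a4 a5 a6 :
  mean mu (fun G => a0 * 1 + a1 * f1 G + a2 * f2 G + a3 * f3 G + a4 * f4 G
                    + a5 * f5 G + a6 * f6 G) =
  a0 * mean mu (fun=> 1) + a1 * mean mu f1 + a2 * mean mu f2 + a3 * mean mu f3
  + a4 * mean mu f4 + a5 * mean mu f5 + a6 * mean mu f6.
Proof. by rewrite !meanD !meanZ. Qed.

Definition rise2 {n} (G : sgraph 'I_n) : R :=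
  \sum_v (deg G v)%:R * ((deg G v)%:R + 1).

Definition rise3 {n} (G : sgraph 'I_n) : R :=
  \sum_v (deg G v)%:R * ((deg G v)%:R + 1) * ((deg G v)%:R + 2).

Definition rise4 {n} (G : sgraph 'I_n) : R :=
  \sum_v (deg G v)%:R * ((deg G v)%:R + 1) * ((deg G v)%:R + 2)
         * ((deg G v)%:R + 3).

Lemma rise2_attach n (G : sgraph 'I_n) j :
  rise2 (attach G j) = rise2 G + 2 * ((deg G j)%:R + 1) + 2.
Proof.
rewrite /rise2 (sum_deg_attach _ _ _ (fun d => d%:R * (d%:R + 1))).
by rewrite -natr1; ring.
Qed.

Lemma rise3_attach n (G : sgraph 'I_n) j : rise3 (attach G j) =
  rise3 G + 3 * (((deg G j)%:R + 1) * ((deg G j)%:R + 2)) + 6.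
Proof.
rewrite /rise3 (sum_deg_attach _ _ _ (fun d => d%:R * (d%:R + 1) * (d%:R + 2))).
by rewrite -natr1; ring.
Qed.

Lemma rise4_attach n (G : sgraph 'I_n) j : rise4 (attach G j) = rise4 G
  + 4 * (((deg G j)%:R + 1) * ((deg G j)%:R + 2) * ((deg G j)%:R + 3)) + 24.
Proof.
rewrite /rise4.
rewrite (sum_deg_attach _ _ _ (fun d => d%:R * (d%:R + 1) * (d%:R + 2) * (d%:R + 3))).
by rewrite -natr1; ring.
Qed.

(** The weight deg(j) completes (d+1), (d+1)(d+2), ... to rising factorials starting at d; this is
    why these are used rather than powers. *)
Lemma growth_step_rising n (f : sgraph 'I_n.+1 -> R) (G : sgraph 'I_n) c0 c1 c2 c3 :
  (\sum_u deg G u)%:R != 0 :> R ->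
  (forall j (x := (deg G j)%:R), f (attach G j) =
     c0 + c1 * (x + 1) + c2 * ((x + 1) * (x + 2))
     + c3 * ((x + 1) * (x + 2) * (x + 3))) ->
  growth_step f G =
    c0 + (c1 * rise2 G + c2 * rise3 G + c3 * rise4 G) / (\sum_u deg G u)%:R.
Proof.
move=> D0 fE; rewrite /growth_step; set D := (\sum_u deg G u)%:R in D0 *.
have -> : c0 = c0 * (\sum_u (deg G u)%:R) / D by rewrite -natr_sum -/D mulfK.
rewrite -mulrDl /rise2 /rise3 /rise4 !mulr_sumr -!big_split mulr_suml.
by apply: eq_bigr => j _; rewrite fE /=; ring.
Qed.

Context (k0 k : nat) (k0k : (k0 <= k)%N).
Let mu := @grown_law R k0 k.
Let N : R := k.+1%:R.

Lemma mean_step (f : sgraph 'I_k.+3 -> R) c0 c1 c2 c3 :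
  (forall (G : sgraph 'I_k.+2) j (x := (deg G j)%:R), f (attach G j) =
     c0 G + c1 G * (x + 1) + c2 G * ((x + 1) * (x + 2))
     + c3 G * ((x + 1) * (x + 2) * (x + 3))) ->
  mean (grown_law k0 k.+1) f = mean mu (fun G =>
    c0 G + (c1 G * rise2 G + c2 G * rise3 G + c3 G * rise4 G) / (2 * N)).
Proof.
move=> fE; rewrite mean_grown_law //; apply: eq_mean => G.
move=> /(sum_deg_grown_law _ _ _ k0k) dG.
have D0 : (\sum_u deg G u)%:R != 0 :> R by rewrite dG mulf_neq0 ?pnatr_eq0.
by rewrite (growth_step_rising _ _ _ _ _ _ _ D0 (fE G)) dG.
Qed.

Let mean1 : mean mu (fun=> 1) = 1.
Proof. exact: mean_grown_law1. Qed.

Let N_neq0 : N != 0.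
Proof. by rewrite pnatr_eq0. Qed.

Let m2 := mean mu rise2.
Let m3 := mean mu rise3.
Let m4 := mean mu rise4.
Let Y (G : sgraph 'I_k.+2) := rise2 G - m2.

Lemma mean_rise2S :
  mean (grown_law k0 k.+1) rise2 = m2 * (1 + 1 / N) + 2.
Proof.
rewrite (mean_step _ (fun G => rise2 G + 2) (fun=> 2) (fun=> 0) (fun=> 0)).
  rewrite (eq_mean _ _ _ (fun G => 2 * 1 + (1 + 1 / N) * rise2 G + 0 * rise2 G
    + 0 * rise2 G + 0 * rise2 G + 0 * rise2 G + 0 * rise2 G)).
    by rewrite mean_comb mean1 -/m2; ring.
  by move=> G _; move: (N) N_neq0 => x x0; field.
by move=> G j x; rewrite rise2_attach -/x; ring.
Qed.

Lemma mean_rise3S :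
  mean (grown_law k0 k.+1) rise3 = m3 * (1 + 3 / (2 * N)) + 6.
Proof.
rewrite (mean_step _ (fun G => rise3 G + 6) (fun=> 0) (fun=> 3) (fun=> 0)).
  rewrite (eq_mean _ _ _ (fun G => 6 * 1 + (1 + 3 / (2 * N)) * rise3 G
    + 0 * rise2 G + 0 * rise2 G + 0 * rise2 G + 0 * rise2 G + 0 * rise2 G)).
    by rewrite mean_comb mean1 -/m3; ring.
  by move=> G _; move: (N) N_neq0 => x x0; field.
by move=> G j x; rewrite rise3_attach -/x; ring.
Qed.

Lemma mean_rise4S :
  mean (grown_law k0 k.+1) rise4 = m4 * (1 + 2 / N) + 24.
Proof.
rewrite (mean_step _ (fun G => rise4 G + 24) (fun=> 0) (fun=> 0) (fun=> 4)).
  rewrite (eq_mean _ _ _ (fun G => 24 * 1 + (1 + 2 / N) * rise4 G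
    + 0 * rise2 G + 0 * rise2 G + 0 * rise2 G + 0 * rise2 G + 0 * rise2 G)).
    by rewrite mean_comb mean1 -/m4; ring.
  by move=> G _; move: (N) N_neq0 => x x0; field.
by move=> G j x; rewrite rise4_attach -/x; ring.
Qed.

Let A := m2 / N.

Let meanY : mean mu Y = 0.
Proof.
rewrite (eq_mean _ _ _ (fun G => - m2 * 1 + 1 * rise2 G
  + 0 * rise2 G + 0 * rise2 G + 0 * rise2 G + 0 * rise2 G + 0 * rise2 G)).
  by rewrite mean_comb mean1 -/m2; ring.
by move=> G _; rewrite /Y; ring.
Qed.

Let centered_attach (G : sgraph 'I_k.+2) j :
  rise2 (attach G j) - mean (grown_law k0 k.+1) rise2 =
  Y G - A + 2 * ((deg G j)%:R + 1).
Proof. by rewrite rise2_attach mean_rise2S /Y /A; move: (N) N_neq0 => x x0; field. Qed.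

Lemma var_rise2S :
  mean (grown_law k0 k.+1)
    (fun G => (rise2 G - mean (grown_law k0 k.+1) rise2) ^+ 2) =
  mean mu (fun G => Y G ^+ 2) * (1 + 2 / N) + 2 * (m3 / N - A) - A ^+ 2.
Proof.
rewrite (mean_step _ (fun G => (Y G - A) ^+ 2) (fun G => 4 * Y G - 4 * A - 4)
  (fun=> 4) (fun=> 0)); last first.
  by move=> G j x; rewrite centered_attach -/x; ring.
rewrite (eq_mean _ _ _ (fun G =>
  (A ^+ 2 - (4 * A + 4) * m2 / (2 * N)) * 1
  + (1 + 2 / N) * Y G ^+ 2 + (- 2 * A + (4 * m2 - 4 * A - 4) / (2 * N)) * Y G
  + (2 / N) * rise3 G + 0 * rise2 G + 0 * rise2 G + 0 * rise2 G)).
  by rewrite mean_comb mean1 meanY -/m3 /A; move: (N) N_neq0 => x x0; field.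
by move=> G _; rewrite /Y /A; move: (N) N_neq0 => x x0; field.
Qed.

Lemma cov_rise23S :
  mean (grown_law k0 k.+1)
    (fun G => (rise2 G - mean (grown_law k0 k.+1) rise2) * rise3 G) =
  mean mu (fun G => Y G * rise3 G) * (1 + 5 / (2 * N))
  + 3 * (m4 / N - 2 * (m3 / N)) - 3 / 2 * A * (m3 / N).
Proof.
rewrite (mean_step _ (fun G => (Y G - A) * (rise3 G + 6))
  (fun G => 2 * (rise3 G + 6)) (fun G => 3 * (Y G - A) - 12) (fun=> 6)); last first.
  by move=> G j x; rewrite centered_attach rise3_attach -/x; ring.
rewrite (eq_mean _ _ _ (fun G =>
  (- 6 * A + 12 * m2 / (2 * N)) * 1
  + (1 + 5 / (2 * N)) * (Y G * rise3 G) + (6 + 12 / (2 * N)) * Y G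
  + (- A + (2 * m2 - 3 * A - 12) / (2 * N)) * rise3 G + (3 / N) * rise4 G
  + 0 * rise2 G + 0 * rise2 G)).
  by rewrite mean_comb mean1 meanY -/m3 -/m4 /A; move: (N) N_neq0 => x x0; field.
by move=> G _; rewrite /Y /A; move: (N) N_neq0 => x x0; field.
Qed.

(** Expand the cube of [Y] plus the centred jump. The conditional mean of the latter is [Y / N],
    whence 3 / N; the last summand is the third central moment of the jump. *)
Lemma third_rise2S (B := m3 / N) (C := m4 / N) :
  mean (grown_law k0 k.+1)
    (fun G => (rise2 G - mean (grown_law k0 k.+1) rise2) ^+ 3) =
  mean mu (fun G => Y G ^+ 3) * (1 + 3 / N)
  + 6 * (mean mu (fun G => Y G * rise3 G)
         - mean mu (fun G => Y G ^+ 2) * (1 + A)) / N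
  + (4 * (C - 3 * B + A) - 6 * A * (B - A) + 2 * A ^+ 3).
Proof.
rewrite (mean_step _ (fun G => (Y G - A) ^+ 3)
  (fun G => 6 * (Y G - A) ^+ 2 - 12 * (Y G - A) + 8)
  (fun G => 12 * (Y G - A) - 24) (fun=> 8)); last first.
  by move=> G j x; rewrite centered_attach -/x; ring.
rewrite (eq_mean _ _ _ (fun G =>
  (- A ^+ 3 + m2 * (6 * A ^+ 2 + 12 * A + 8) / (2 * N)) * 1
  + (1 + 3 / N) * Y G ^+ 3
  + (- 3 * A + (6 * m2 - 12 * A - 12) / (2 * N)) * Y G ^+ 2
  + (3 * A ^+ 2 + (- 12 * A * m2 - 12 * m2 + 6 * A ^+ 2 + 12 * A + 8) / (2 * N)) * Y G
  + (6 / N) * (Y G * rise3 G)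
  + ((- 12 * A - 24) / (2 * N)) * rise3 G + (4 / N) * rise4 G)).
  by rewrite mean_comb mean1 meanY -/m3 -/m4 /B /C /A; move: (N) N_neq0 => x x0; field.
by move=> G _; rewrite /Y /A; move: (N) N_neq0 => x x0; field.
Qed.

End Moments.

(** * Moments of the tree grown from a single edge *)

Section PlainTreeMoments.
Context {R : realFieldType}.
Let law k := @grown_law R 0 k.

Lemma rise2_star k :
  rise2 (star k) = k.+1%:R * (k.+1%:R + 1) + k.+1%:R * 2 :> R.
Proof.
rewrite /rise2 (sum_deg_starE _ (fun d => d%:R * (d%:R + 1))).
by move: (k.+1%:R) => x; ring.
Qed.

Lemma rise3_star k :
  rise3 (star k) = k.+1%:R * (k.+1%:R + 1) * (k.+1%:R + 2) + k.+1%:R * 6 :> R.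
Proof.
rewrite /rise3 (sum_deg_starE _ (fun d => d%:R * (d%:R + 1) * (d%:R + 2))).
by move: (k.+1%:R) => x; ring.
Qed.

Lemma rise4_star0 : rise4 (star 0) = 48 :> R.
Proof.
rewrite /rise4.
rewrite (sum_deg_starE _ (fun d => d%:R * (d%:R + 1) * (d%:R + 2) * (d%:R + 3))).
by ring.
Qed.

Lemma mean_rise2E k : mean (law k) rise2 = k.+1%:R * mean2 k.
Proof.
elim: k => [|k IH]; first by rewrite mean_start rise2_star /=; ring.
rewrite mean_rise2S // IH mean2S (natSS k).
by have := natS_ge1 (R := R) k; move: (k.+1%:R) => x x1; field; apply/andP; split; lra.
Qed.

Lemma mean_rise3E k : mean (law k) rise3 = k.+1%:R * mean3 k.
Proof.
elim: k => [|k IH]; first by rewrite mean_start rise3_star /=; ring.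
rewrite mean_rise3S // IH mean3S (natSS k).
by have := natS_ge1 (R := R) k; move: (k.+1%:R) => x x1; field; apply/andP; split; lra.
Qed.

Lemma mean_rise4E k : mean (law k) rise4 = k.+1%:R * (36 * k.+1%:R + 12).
Proof.
elim: k => [|k IH]; first by rewrite mean_start rise4_star0; ring.
rewrite mean_rise4S // IH (natSS k).
by have := natS_ge1 (R := R) k; move: (k.+1%:R) => x x1; field; lra.
Qed.

Lemma var_rise2E k :
  mean (law k) (fun G => (rise2 G - mean (law k) rise2) ^+ 2) = var2 k.
Proof.
elim: k => [|k IH]; first by rewrite !mean_start subrr expr0n.
rewrite var_rise2S // IH var2S mean_rise2E mean_rise3E.
by rewrite !(mulrC k.+1%:R) !mulfK ?pnatr_eq0 //; ring.
Qed.

Lemma cov_rise23E k :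
  mean (law k) (fun G => (rise2 G - mean (law k) rise2) * rise3 G) = cov23 k.
Proof.
elim: k => [|k IH]; first by rewrite !mean_start subrr mul0r.
rewrite cov_rise23S // IH cov23S mean_rise2E mean_rise3E mean_rise4E.
by rewrite !(mulrC k.+1%:R) !mulfK ?pnatr_eq0 //; ring.
Qed.

Lemma third_rise2E k :
  mean (law k) (fun G => (rise2 G - mean (law k) rise2) ^+ 3) = third2 k.
Proof.
elim: k => [|k IH]; first by rewrite !mean_start subrr expr0n.
rewrite third_rise2S // IH third2S /jump3 var_rise2E cov_rise23E.
rewrite mean_rise2E mean_rise3E mean_rise4E.
have := natS_ge1 (R := R) k; move: (k.+1%:R) => x x1; field; lra.
Qed.

End PlainTreeMoments.

Lemma var2_gt0 {R : realFieldType} k : (2 <= k)%N -> 0 < var2 k :> R.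
Proof.
move=> k2; rewrite -(subnKC k2); elim: (k - 2)%N => [|i IH].
  rewrite addn0 var2S -addrA ltr_wpDl //; last by rewrite /=; lra.
  by rewrite mulr_ge0 ?var2_ge0 // addr_ge0 // divr_ge0.
rewrite addnS var2S; have := jump_var_ge0 (R := R) (2 + i); rewrite /jump_var.
have : 0 < var2 (2 + i) * (1 + 2 / (2 + i).+1%:R) :> R.
  by rewrite mulr_gt0 // ltr_wpDr // divr_ge0.
by move: (var2 _ * _) => u; lra.
Qed.

(** * Upper tail from early stars *)

Section Tail.
Context {R : realFieldType}.
Context (k0 k : nat) (k0k : (k0 <= k)%N).

Lemma rise_ge0 n (G : sgraph 'I_n) : 0 <= rise2 G :> R /\ 0 <= rise3 G :> R.
Proof.
by split; apply: sumr_ge0 => v _; rewrite !mulr_ge0 // addr_ge0.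
Qed.

Lemma mean_ge0 n (mu f : sgraph 'I_n -> R) :
  (forall G, 0 <= mu G) -> (forall G, 0 <= f G) -> 0 <= mean mu f.
Proof. by move=> mu0 f0; apply: sumr_ge0 => G _; rewrite mulr_ge0. Qed.

(* The left-hand side divided by [N (N + 1)], where [N] is the number of      *)
(* edges, is nonincreasing: the third rising moment telescopes exactly.       *)
Lemma var_rise3_upper :
  mean (grown_law k0 k)
    (fun G => (rise2 G - mean (grown_law k0 k) rise2) ^+ 2)
  + 4 * (mean (grown_law k0 k) rise3 + 12 * k.+1%:R)
  <= (4 * k0.+1%:R + 44) * (k.+1%:R * (k.+1%:R + 1)) :> R.
Proof.
rewrite -(subnKC k0k); elim: (k - k0)%N => [|i IH].
  rewrite addn0 !mean_start subrr expr0n /= rise3_star.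
  have := natS_ge1 (R := R) k0; move: (k0.+1%:R) => x x1.
  have : 0 <= x * (x - 1) by rewrite mulr_ge0; lra.
  lra.
rewrite addnS; move: IH; set j := (k0 + i)%N => IH.
have k0j : (k0 <= j)%N by exact: leq_addr.
rewrite var_rise2S // mean_rise3S // (natSS j).
move: IH; set V := mean _ (fun G => _ ^+ 2).
have [a0 r0] : 0 <= mean (grown_law k0 j) rise2 :> R /\
    0 <= mean (grown_law k0 j) rise3 :> R.
  by split; apply: mean_ge0 => G; rewrite ?grown_law_ge0 //; case: (rise_ge0 _ G).
move: V (mean _ rise2) (mean _ rise3) a0 r0 => V a r a0 r0.
have := natS_ge1 (R := R) j; move: (j.+1%:R) (4 * k0.+1%:R + 44) => x K x1 IH.
have A0 : 0 <= a / x by rewrite divr_ge0 //; lra.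
have step : (V + 4 * (r + 12 * x)) * (1 + 2 / x) <= K * (x * (x + 1)) * (1 + 2 / x).
  by rewrite ler_wpM2r // addr_ge0 // divr_ge0 //; lra.
have E1 : (V + 4 * (r + 12 * x)) * (1 + 2 / x) =
  V * (1 + 2 / x) + 2 * (r / x) + 4 * (r * (1 + 3 / (2 * x)) + 6 + 12 * (x + 1)) + 24.
  by field; lra.
have E2 : K * (x * (x + 1)) * (1 + 2 / x) = K * ((x + 1) * (x + 1 + 1)).
  by field; lra.
rewrite E1 E2 in step; have A2 := sqr_ge0 (a / x).
move: (a / x) ((a / x) ^+ 2) A0 A2 (V * _) (r / x) (r * _) step => A A2 A0 A20 V' r' r''.
by move: (K * _) => K'; lra.
Qed.

Lemma var_rise2_upper :
  mean (grown_law k0 k)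
    (fun G => (rise2 G - mean (grown_law k0 k) rise2) ^+ 2)
  <= (4 * k0.+1%:R + 44) * (k.+1%:R * (k.+1%:R + 1)) :> R.
Proof.
apply: le_trans var_rise3_upper; rewrite lerDl mulr_ge0 // addr_ge0 ?mulr_ge0 //.
by apply: mean_ge0 => G; rewrite ?grown_law_ge0 //; case: (rise_ge0 _ G).
Qed.

Lemma mean2_upper i : mean2 i <= i.+1%:R / 2 + 6 :> R.
Proof.
have small j : (j <= 2)%N -> mean2 j <= j.+1%:R / 2 + 6 :> R.
  by case: j => [|[|[|j]]] // _ /=; lra.
have [/small//|/ltnW i2] := leqP i 2.
rewrite -(subnKC i2); elim: (i - 2)%N => [|j IH]; first exact: small.
rewrite addnS mean2S (natSS (2 + j)).
have : 2 / ((2 + j).+1%:R + 1) <= 1 / 2 :> R.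
  have : 3 <= (2 + j).+1%:R :> R by rewrite ler_nat.
  by move: ((2 + j).+1%:R) => x x3; rewrite ler_pdivrMr; lra.
by move: (2 / _) IH => u; move: ((2 + j).+1%:R) => x; lra.
Qed.

(** The mean of [rise2] per edge receives the same increments from any start, so the initial gap
    persists. With m edges it is m + 3 for the star and at most m/2 + 6 for the tree. *)
Lemma mean_rise2_gap : k.+1%:R * (k0.+1%:R / 2 - 3) <=
  mean (grown_law k0 k) rise2 - mean (grown_law 0 k) rise2 :> R.
Proof.
rewrite -(subnKC k0k); elim: (k - k0)%N => [|i].
  rewrite addn0 mean_start rise2_star mean_rise2E -mulrDr -mulrBr.
  rewrite ler_pM2l //; have := mean2_upper k0.
  by move: (k0.+1%:R) => x; lra.
rewrite addnS; set j := (k0 + i)%N => IH.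
have k0j : (k0 <= j)%N by exact: leq_addr.
rewrite !mean_rise2S // (natSS j); have := natS_ge1 (R := R) j.
move: (mean (grown_law k0 j) rise2) (mean (grown_law 0 j) rise2) IH.
move: (j.+1%:R) (k0.+1%:R / 2 - 3).
move=> x g a b IH x1.
have -> : a * (1 + 1 / x) + 2 - (b * (1 + 1 / x) + 2) = (a - b) * (1 + 1 / x).
  by ring.
have -> : (x + 1) * g = (x * g) * (1 + 1 / x) by field; lra.
by rewrite ler_wpM2r // addr_ge0 // divr_ge0 //; lra.
Qed.

Lemma chebyshev_lower n (mu f : sgraph 'I_n -> R) (m e : R) :
  (forall G, 0 <= mu G) -> mean mu (fun=> 1) = 1 -> 0 < e ->
  1 - mean mu (fun G => (f G - m) ^+ 2) / e ^+ 2 <=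
  mean mu (fun G => (m - e <= f G)%R%:R).
Proof.
move=> mu0 mu1 e0; rewrite lerBlDr -[leLHS]mu1 mulrC -meanZ -meanD.
apply: le_mean => // G _; have [_|] := boolP (m - e <= f G).
  by rewrite lerDl mulr_ge0 ?invr_ge0 ?sqr_ge0.
rewrite -ltNge add0r mulrC => lt_e.
rewrite ler_pdivlMr ?exprn_gt0 // mul1r -[leRHS]sqrrN ler_sqr ?nnegrE; lra.
Qed.

Lemma rise2_tail : (300 <= k0)%N -> 2 ^- k0.+1 <=
  mean (grown_law 0 k) (fun G =>
    (mean (grown_law 0 k) rise2 + k.+1%:R * (k0.+1%:R / 5) <= rise2 G :> R)%R%:R) :> R.
Proof.
move=> k0_big.
have m300 : 301 <= k0.+1%:R :> R by rewrite ler_nat.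
have x1 := natS_ge1 (R := R) k.
have e0 : 0 < k.+1%:R * (k0.+1%:R / 4) :> R by rewrite mulr_gt0 //; lra.
have cheb := chebyshev_lower _ (grown_law k0 k) rise2
  (mean (grown_law k0 k) rise2) _ (grown_law_ge0 k0 k) (mean_grown_law1 _ _ k0k) e0.
have half : 1 / 2 <= mean (grown_law k0 k) (fun G =>
    (mean (grown_law k0 k) rise2 - k.+1%:R * (k0.+1%:R / 4) <= rise2 G :> R)%R%:R) :> R.
  apply: le_trans cheb; rewrite lerBrDr -lerBrDl ler_pdivrMr ?exprn_gt0 //.
  apply: (le_trans var_rise2_upper).
  move: (k.+1%:R) (k0.+1%:R) x1 m300 => x m x1 m300.
  (* Chebyshev needs this to be at most half the squared deviation, that is, m^2 >= 256 m + 2816;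
     this is where [k0] must be large. *)
  apply: (@le_trans _ _ ((4 * m + 44) * (2 * x ^+ 2))).
    have : 0 <= x * (x - 1) by rewrite mulr_ge0; lra.
    by move=> h; apply: ler_wpM2l; lra.
  rewrite [leRHS](_ : _ = (m ^+ 2 / 64) * (2 * x ^+ 2)); last by field.
  have : 0 <= m * (m - 301) by rewrite mulr_ge0; lra.
  by move=> h; apply: ler_wpM2r; rewrite ?mulr_ge0 ?sqr_ge0 //; lra.
rewrite exprSr invfM -[2^-1]div1r.
apply: le_trans (_ : 2 ^- k0 * _ <= _).
  by apply: ler_wpM2l half; rewrite invr_ge0 exprn_ge0.
rewrite mulr_sumr; apply: ler_sum => G _; rewrite [leLHS]mulrA.
apply: ler_pM; rewrite ?mulr_ge0 ?invr_ge0 ?exprn_ge0 ?grown_law_ge0 //.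
  exact: grown_law_star_lower.
have [le_G|//] := boolP (_ - _ <= _).
rewrite ler_nat lt0b; apply: le_trans le_G; have := mean_rise2_gap.
have : k.+1%:R * (k0.+1%:R / 4) + k.+1%:R * (k0.+1%:R / 5)
    <= k.+1%:R * (k0.+1%:R / 2 - 3) :> R.
  rewrite -mulrDr; apply: ler_wpM2l => //.
  by move: (k0.+1%:R) m300 => m m300; lra.
move: (_ * (_ / 4)) (_ * (_ / 5)) (_ * (_ / 2 - 3)) => u w z.
by move: (mean _ _) (mean _ _) => a b; lra.
Qed.

End Tail.

(** * Tail bound and continuity for normal laws *)

Section NormalLaw.
Context {R : realType} (m s : R) (s_gt0 : 0 < s).
Let s_neq0 : s != 0. Proof. exact: lt0r_neq0. Qed.

Lemma normal_pdf_tilt l x : expR (l * x) * normal_pdf m s x =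
  expR (l * m + l ^+ 2 * s ^+ 2 / 2) * normal_pdf (m + l * s ^+ 2) s x.
Proof.
rewrite !normal_pdfE // mulrCA [RHS]mulrCA; congr (_ * _).
by rewrite /normal_fun -!expRD; congr expR; field.
Qed.

(** Chernoff's bound: on the tail the density is at most a constant times the tilted density, whose
    total mass is 1. *)
Lemma normal_prob_upper_tail l x : 0 <= l ->
  (normal_prob m s `]x, +oo[%classic <=
   (expR (- (l * x)) * expR (l * m + l ^+ 2 * s ^+ 2 / 2))%:E)%E.
Proof.
move=> l0; set c := expR (- (l * x)) * _.
have mpdf a : measurable_fun [set: R] (fun y => (normal_pdf a s y)%:E).
  by apply/measurable_EFinP; exact: measurable_normal_pdf.
have mc : measurable_fun [set: R]
    (fun y => (c * normal_pdf (m + l * s ^+ 2) s y)%:E).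
  apply/measurable_EFinP; apply: measurable_funM => //.
  exact: measurable_normal_pdf.
have c0 : 0 <= c by rewrite mulr_ge0 ?expR_ge0.
apply: (@le_trans _ _ (\int[lebesgue_measure]_(y in `]x, +oo[%classic)
    (c * normal_pdf (m + l * s ^+ 2) s y)%:E)%E).
  apply: ge0_le_integral => //.
  - by move=> y _; rewrite lee_fin normal_pdf_ge0.
  - exact: measurable_funTS (mpdf m).
  - exact: measurable_funTS mc.
  - move=> y /=; rewrite in_itv /= andbT => xy; rewrite lee_fin.
    rewrite /c -mulrA -(normal_pdf_tilt l y) mulrA -expRD.
    rewrite ler_peMl ?normal_pdf_ge0 //.
    rewrite -[leLHS]expR0 ler_expR addrC -mulrBr mulr_ge0 // subr_ge0 ltW //.
apply: (@le_trans _ _ (\int[lebesgue_measure]_y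
    (c * normal_pdf (m + l * s ^+ 2) s y)%:E)%E).
  apply: ge0_subset_integral => //.
  by move=> y _; rewrite lee_fin mulr_ge0 ?normal_pdf_ge0.
under eq_integral do rewrite EFinM.
rewrite ge0_integralZl //; first by rewrite integral_normal_pdf mule1.
  exact: mpdf.
by move=> y _; rewrite lee_fin normal_pdf_ge0.
Qed.

Lemma normal_prob_itv_le x y : x <= y ->
  (normal_prob m s `]x, y]%classic <= (normal_peak s * (y - x))%:E)%E.
Proof.
move=> xy; apply: (@le_trans _ _
  (\int[lebesgue_measure]_(z in `]x, y]%classic) (normal_peak s)%:E)%E).
  apply: ge0_le_integral => //.
  - by move=> z _; rewrite lee_fin normal_pdf_ge0.
  - apply: measurable_funTS; apply/measurable_EFinP.
    exact: measurable_normal_pdf.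
  - by move=> z _; rewrite lee_fin normal_pdf_ub.
rewrite integral_cst //= lebesgue_measure_itv /= lte_fin EFinM.
case: ifP => [_|]; first by rewrite EFinB.
by rewrite mule0 lee_fin mulr_ge0 ?normal_peak_ge0 // subr_ge0.
Qed.

Context {d : measure_display} {Omega : measurableType d}.
Context (P : probability Omega R) (Y : {RV P >-> R}).
Hypothesis normalY :
  forall A : set R, measurable A -> distribution P Y A = normal_prob m s A.

Let cdfE x : cdf Y x = (fine (cdf Y x))%:E.
Proof. by rewrite fineK // fin_num_measure. Qed.

Lemma cdf_normalB x y : x <= y ->
  fine (cdf Y x) <= fine (cdf Y y) <= fine (cdf Y x) + normal_peak s * (y - x).
Proof.
move=> xy; rewrite -!lee_fin EFinD -!cdfE cdf_nondecreasing //=.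
rewrite {1}/cdf (@itv_bndbnd_setU _ _ -oo%O (BRight x) (BRight y)) //.
apply: le_trans (measureU2 _ _ _) _ => //; rewrite -/(cdf Y x).
by apply: leeD2l; have := normal_prob_itv_le _ _ xy; rewrite -normalY.
Qed.

Lemma cdf_normal_lipschitz x y :
  `|fine (cdf Y x) - fine (cdf Y y)| <= normal_peak s * `|x - y|.
Proof.
wlog xy : x y / x <= y.
  move=> le_case; case/orP: (le_total x y) => [|yx]; first exact: le_case.
  by rewrite distrC (distrC x); exact: le_case.
have /andP[h1 h2] := cdf_normalB _ _ xy.
by rewrite !ler0_norm ?subr_le0 // !opprB lerBlDl.
Qed.

(** Makes convergence in distribution available at every point. *)
Lemma continuous_cdf_normal : continuous (cdf Y).
Proof.
move=> x; rewrite /continuous_at cdfE (_ : cdf Y = EFin \o (fine \o cdf Y));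
  last by apply/funext => y /=; rewrite -cdfE.
apply: cvg_EFin; first by near=> y.
apply/cvgrPdist_le => /= e e0.
have peak0 : 0 < normal_peak s by exact: normal_peak_gt0.
near=> y; apply: le_trans (cdf_normal_lipschitz x y) _.
rewrite mulrC -ler_pdivlMr //.
near: y; apply/nbhs_ballP; exists (e / normal_peak s); first exact: divr_gt0.
by move=> z; rewrite /ball /= => /ltW.
Unshelve. all: by end_near. Qed.

End NormalLaw.

(** * From random trees to the finite growth law *)

Section RandomGraphs.
Context {d : measure_display} {Omega : measurableType d} {R : realType}.
Context (P : probability Omega R).

Lemma measurable_graph_event n (T : {RV P >-> sgraph 'I_n}) (A : set (sgraph 'I_n)) :
  measurable (T @^-1` A)%classic.
Proof.
have /(_ measurableT A I) := measurable_funPT T.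
by rewrite setTI.
Qed.

Definition graph_law n (T : {RV P >-> sgraph 'I_n}) (G : sgraph 'I_n) : R :=
  fine (P (T @^-1` [set G])%classic).

Lemma graph_law_ge0 n (T : {RV P >-> sgraph 'I_n}) G : 0 <= graph_law _ T G.
Proof. by rewrite fine_ge0. Qed.

Lemma integral_graph n (T : {RV P >-> sgraph 'I_n}) (f : sgraph 'I_n -> R)
    (D : set Omega) : measurable D ->
  (\int[P]_(w in D) (f (T w))%:E =
   (\sum_G f G * fine (P (T @^-1` [set G] `&` D)%classic))%:E)%E.
Proof.
move=> mD.
have mT G : measurable (T @^-1` [set G])%classic by exact: measurable_graph_event.
have intT G : P.-integrable D (fun w => (\1_(T @^-1` [set G])%classic w)%:E).
  by apply: integrableS (integrable_indic P (mT G)) => //; exact: measurableT.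
have fT w : (f (T w))%:E =
    (\sum_G (f G)%:E * (\1_(T @^-1` [set G])%classic w)%:E)%E.
  rewrite (bigD1 (T w)) //= indicE mem_set // mule1 big1 ?adde0 // => G GT.
  rewrite indicE memNset ?mule0 // => /= TG; by rewrite TG eqxx in GT.
under eq_integral do rewrite fT.
rewrite integral_sum //; last by move=> G; exact: integrableZl.
rewrite -sumEFin; apply: eq_bigr => G _.
rewrite integralZl // integral_indic // EFinM fineK //.
by rewrite fin_num_measure //; exact: measurableI.
Qed.

Lemma expectation_graph n (T : {RV P >-> sgraph 'I_n}) (f : sgraph 'I_n -> R) :
  ('E_P[fun w => f (T w)] = (mean (graph_law _ T) f)%:E)%E.
Proof.
rewrite unlock integral_graph //; congr _%:E; apply: eq_bigr => G _.
by rewrite setIT mulrC.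
Qed.

Lemma probability_graph n (T : {RV P >-> sgraph 'I_n}) (A : pred (sgraph 'I_n)) :
  P [set w | A (T w)]%classic = (mean (graph_law _ T) (fun G => (A G)%:R))%:E.
Proof.
rewrite -expectation_graph -expectation_indic; last first.
  exact: (measurable_graph_event _ T [set G | A G]%classic).
by congr expectation; apply/funext => w; rewrite indicE mem_setE.
Qed.

Lemma graph_law_split n (T : {RV P >-> sgraph 'I_n}) (D : set Omega) :
  measurable D -> fine (P D) = \sum_G fine (P (T @^-1` [set G] `&` D)%classic).
Proof.
move=> mD; have := integral_graph _ T (fun=> 1) D mD.
rewrite integral_cst // mul1e => ->; rewrite /=.
by apply: eq_bigr => G _; rewrite mul1r.
Qed.

Lemma sum_graph_law n (T : {RV P >-> sgraph 'I_n}) : \sum_G graph_law _ T G = 1.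
Proof.
rewrite -[RHS](_ : fine (P setT) = 1); last by rewrite probability_setT.
rewrite (graph_law_split _ T) //.
by apply: eq_bigr => G _; rewrite setIT.
Qed.

Section Tree.
Context (T : forall n, {RV P >-> sgraph 'I_n}).
Hypothesis treeT : plain_oriented_recursive_tree P T.

(** Only an inequality at first: the recursion prescribes joint probabilities for H of the form
    [attach G j] and nothing is known of the others. Equality follows in [graph_lawE], as both laws
    have total mass 1. *)
Lemma graph_lawS_ge k H :
  graph_law _ (T k.+2) = grown_law 0 k ->
  grown_law 0 k.+1 H <= graph_law _ (T k.+3) H.
Proof.
move=> IH; rewrite {1}/grown_law -/(@grown_law R) /= -IH.
rewrite [leRHS](graph_law_split _ (T k.+2)); last exact: measurable_graph_event.
apply: ler_sum => G _; have [_ _ step] := treeT.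
rewrite /growth_step; have [/existsP[j /eqP <-]|no_j] := boolP [exists j, attach G j == H].
  rewrite (bigD1 j) //= eqxx mulr1 [X in _ + X]big1 ?addr0; last first.
    move=> i ij; case: eqP => [/attach_inj/eqP|_]; last by rewrite mulr0.
    by rewrite (negbTE ij).
  rewrite step // fineM ?fin_num_measure //; exact: measurable_graph_event.
rewrite big1 ?mulr0 ?fine_ge0 // => j _.
by move: no_j; rewrite negb_exists => /forallP/(_ j)/negbTE ->; rewrite mulr0.
Qed.

Lemma graph_lawE k : graph_law _ (T k.+2) = grown_law 0 k.
Proof.
elim: k => [|k IH]; apply/funext => G.
  have [_ T2 _] := treeT.
  have law2 : graph_law _ (T 2) (star 0) = 1 by rewrite /graph_law T2.
  have [->|G2] := eqVneq G (star 0); first by rewrite law2 /= eqxx.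
  rewrite /= (negbTE G2) -[RHS]/(0 : R); apply/eqP; rewrite eq_le graph_law_ge0 andbT.
  have := sum_graph_law _ (T 2); rewrite (bigD1 (star 0)) //= law2.
  move/(canRL (addKr _)); rewrite addNr (bigD1 G) //= => <-.
  by rewrite lerDl sumr_ge0 // => H _; exact: graph_law_ge0.
have sum1 : \sum_H (graph_law _ (T k.+3) H - grown_law 0 k.+1 H) = 0.
  rewrite sumrB sum_graph_law; have := mean_grown_law1 (R := R) 0 k.+1 isT.
  by rewrite /mean; under eq_bigr do rewrite mulr1; move=> ->; rewrite subrr.
apply/eqP; rewrite -subr_eq0; apply/eqP.
move/eqP: sum1; rewrite psumr_eq0; last by move=> H _; rewrite subr_ge0 graph_lawS_ge.
by move/allP => /(_ G (mem_index_enum _))/eqP.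
Qed.

Lemma zagreb_rise2 k G : grown_law 0 k G != 0 :> R ->
  (zagreb G)%:R = rise2 G - 2 * k.+1%:R :> R.
Proof.
move=> /(sum_deg_grown_law 0 k G (leq0n k)) <-.
rewrite /zagreb /rise2 !natr_sum -sumrB; apply: eq_bigr => v _.
by rewrite natrX; ring.
Qed.

Let mu2 k : R := mean (grown_law 0 k) rise2.

Lemma expectation_zagreb k :
  ('E_P[zagreb_rv P (T k.+2)] = (mu2 k - 2 * k.+1%:R)%R%:E)%E.
Proof.
rewrite (expectation_graph _ _ (fun G => (zagreb G)%:R)) graph_lawE; congr _%:E.
rewrite (eq_mean _ _ _ (fun G => rise2 G + (- (2 * k.+1%:R)) * 1)).
  by rewrite meanD meanZ mean_grown_law1 // mulr1.
by move=> G /zagreb_rise2 ->; rewrite mulr1.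
Qed.

Lemma variance_zagreb k : ('V_P[zagreb_rv P (T k.+2)] = (var2 k)%:E)%E.
Proof.
rewrite /variance unlock expectation_zagreb /=.
pose f (G : sgraph 'I_k.+2) : R :=
  ((zagreb G)%:R - (mu2 k - 2 * k.+1%:R)) * ((zagreb G)%:R - (mu2 k - 2 * k.+1%:R)).
rewrite (expectation_graph _ _ f) graph_lawE -var_rise2E; congr _%:E.
by apply: eq_mean => G /zagreb_rise2 e; rewrite /f e /mu2; ring.
Qed.

Lemma standardize_zagreb k w : standardize P (zagreb_rv P (T k.+2)) w =
  ((zagreb (T k.+2 w))%:R - (mu2 k - 2 * k.+1%:R)) / Num.sqrt (var2 k).
Proof. by rewrite /standardize expectation_zagreb variance_zagreb. Qed.

Lemma skewness_zagreb k : skewness P (zagreb_rv P (T k.+2)) =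
  (third2 k / Num.sqrt (var2 k) ^+ 3)%:E.
Proof.
rewrite /skewness.
pose f (G : sgraph 'I_k.+2) : R :=
  (((zagreb G)%:R - (mu2 k - 2 * k.+1%:R)) / Num.sqrt (var2 k)) ^+ 3.
rewrite (_ : (fun w => _) = fun w => f (T k.+2 w)); last first.
  by apply/funext => w; rewrite standardize_zagreb.
rewrite expectation_graph graph_lawE -third_rise2E mulrC -meanZ; congr _%:E.
by apply: eq_mean => G /zagreb_rise2 e; rewrite /f e exprMn exprVn /mu2; ring.
Qed.

(** The variance is at most 48 N(N+1) <= 96 N^2 for N edges, and 96 <= 14^2; with 14, the 1/5 of
    [rise2_tail] becomes 1/70. *)
Lemma sqrt_var2_upper k : Num.sqrt (var2 k) <= 14 * k.+1%:R :> R.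
Proof.
have x1 := natS_ge1 (R := R) k.
rewrite -[leRHS]ger0_norm ?mulr_ge0 // -sqrtr_sqr ler_wsqrtr //.
rewrite -var_rise2E; apply: le_trans (var_rise2_upper 0 k (leq0n k)) _.
move: (k.+1%:R) x1 => x x1; have : 0 <= x * (x - 1) by rewrite mulr_ge0; lra.
lra.
Qed.

Lemma skewness_zagreb_lower k : (3 <= k)%N ->
  ((normalized_third 3 / 14 ^+ 3)%:E <= skewness P (zagreb_rv P (T k.+2)))%E.
Proof.
move=> k3; rewrite skewness_zagreb lee_fin.
have v0 : 0 < Num.sqrt (var2 k) :> R by rewrite sqrtr_gt0 var2_gt0 // ltnW.
rewrite ler_pdivlMr ?exprn_gt0 // mulrAC ler_pdivrMr ?exprn_gt0 //.
apply: (@le_trans _ _ (normalized_third 3 * (14 * k.+1%:R) ^+ 3)).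
  rewrite ler_pM2l ?normalized_third3_gt0 //.
  by rewrite lerXn2r ?nnegrE ?sqrtr_ge0 ?mulr_ge0 ?sqrt_var2_upper.
rewrite exprMn mulrCA mulrC ler_pM2r ?exprn_gt0 //.
exact: third2_lower.
Qed.

Lemma standardize_zagreb_tail k0 k : (300 <= k0)%N -> (k0 <= k)%N ->
  ((2 ^- k0.+1)%:E <=
   P [set w | (k0.+1%:R / 70 <= standardize P (zagreb_rv P (T k.+2)) w)%R]%classic)%E.
Proof.
move=> k0_big k0k.
pose A (G : sgraph 'I_k.+2) := (k0.+1%:R / 70 <=
  ((zagreb G)%:R - (mu2 k - 2 * k.+1%:R)) / Num.sqrt (var2 k) :> R)%R.
rewrite (_ : [set w | _]%classic = [set w | A (T k.+2 w)]%classic); last first.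
  by apply/funext => w; rewrite /= standardize_zagreb.
rewrite probability_graph graph_lawE lee_fin.
apply: le_trans (rise2_tail k0 k k0k k0_big) _.
apply: le_mean => [G|G /zagreb_rise2 e]; first exact: grown_law_ge0.
have [tail|//] := boolP (_ <= rise2 G); rewrite ler_nat lt0b /A e.
have v0 : 0 < Num.sqrt (var2 k) :> R.
  by rewrite sqrtr_gt0 var2_gt0 // (leq_trans _ k0k) // (leq_trans _ k0_big).
rewrite ler_pdivlMr //.
apply: (@le_trans _ _ (k0.+1%:R / 70 * (14 * k.+1%:R))).
  by rewrite ler_wpM2l ?divr_ge0 // sqrt_var2_upper.
rewrite /mu2; have -> : k0.+1%:R / 70 * (14 * k.+1%:R) = k.+1%:R * (k0.+1%:R / 5) :> R.
  by field.
by move: tail; move: (_ * (_ / 5)) => u; move: (mean _ _) => a; lra.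
Qed.

End Tree.
End RandomGraphs.

(** * Lower limit of the skewness and failure of normality *)

Lemma limn_einf_lower {R : realType} (u : nat -> \bar R) (c : \bar R) n0 :
  (forall n, (n0 <= n)%N -> (c <= u n)%E) -> (c <= limn_einf u)%E.
Proof.
move=> cu; rewrite limn_einf_lim (cvg_lim _ (@cvg_einfs_sup _ u)) //.
apply: le_trans (ereal_sup_ubound (_ : range (einfs u) (einfs u n0))).
  by apply: le_ereal_inf_tmp => _ [n /= n0n <-]; exact: cu.
by exists n0.
Qed.

(** As e >= 2, the right-hand side is at most C exp(-j) 2^(-j) with j = k + 1 when C >= 0, and C < j
    <= exp(j) once k exceeds the truncation of |C|. *)
Lemma not_exp_dominated {R : realType} (C : R) :
  ~ forall k, (300 <= k)%N -> 2 ^- k.+1 <= C * expR (- (2 * k.+1%:R)).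
Proof.
move=> dom; set k := (300 + Num.truncn `|C|)%N.
have := dom k (leq_addr _ _); apply/negP; rewrite -ltNge.
set j := k.+1; have Cj : C < j%:R.
  apply: le_lt_trans (ler_norm C) _; apply: lt_le_trans (truncnS_gt _) _.
  by rewrite ler_nat /j /k ltnS leq_addl.
have e2 : 2 <= expR 1 :> R by have := expR_ge1Dx (1 : R); lra.
have ej : j%:R <= expR j%:R :> R by have := expR_ge1Dx (j%:R : R); lra.
have -> : - (2 * j%:R) = - j%:R - j%:R :> R by ring.
rewrite expRD mulrA; apply: (@lt_le_trans _ _ (expR (- j%:R))).
  rewrite gtr_pMl ?expR_gt0 // expRN ltr_pdivrMr ?expR_gt0 // mul1r.
  exact: lt_le_trans Cj ej.
rewrite expRN lef_pV2 ?posrE ?exprn_gt0 ?expR_gt0 //.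
by rewrite -[j%:R]mulr1 expRM_natl lerXn2r ?nnegrE ?expR_ge0.
Qed.

Theorem theorem2 (R : realType) (d : measure_display) (Omega : measurableType d)
    (P : probability Omega R) (T : forall n : nat, {RV P >-> sgraph 'I_n})
    (hT : plain_oriented_recursive_tree P T) :
  (0 < limn_einf (fun n : nat => skewness P (zagreb_rv P (T n))))%E /\
  forall (d' : measure_display) (Omega' : measurableType d')
    (P' : probability Omega' R) (Y : {RV P' >-> R}),
    normal_rv P' Y ->
    ~ cvg_in_distribution P P'
        (fun n : nat => standardize P (zagreb_rv P (T n))) Y.
Proof.
split.
  apply: lt_le_trans (limn_einf_lower _ (normalized_third 3 / 14 ^+ 3)%:E 5 _).
    by rewrite lte_fin divr_gt0 ?normalized_third3_gt0.
  case=> [|[|k]] // k3; exact: skewness_zagreb_lower.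
move=> d' Omega' P' Y [m [s [s0 normalY]]] cvgY.
apply: (@not_exp_dominated R (expR (200 * m + 200 ^+ 2 * s ^+ 2 / 2))) => k0 k0_big.
(* Since 1/100 < 1/70, the event of being at most [x] misses the tail event; and the Chernoff
   parameter 200 gives 200 * x = 2 * k0.+1. *)
set x : R := k0.+1%:R / 100.
have cdf_le : (cdf Y x <= (1 - 2 ^- k0.+1)%:E)%E.
  have cvgx := cvgY x (continuous_cdf_normal m s s0 P' Y normalY x).
  rewrite -(cvg_lim _ cvgx) //; apply: lime_le; first by apply/cvg_ex; exists (cdf Y x).
  near=> n; have [k nE k0k] : exists2 k, n = k.+2 & (k0 <= k)%N.
    have : (k0.+2 <= n)%N by near: n; exact: nbhs_infty_ge.
    by case: (n) => [|[|k]] // ?; exists k.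
  rewrite nE; have tail := standardize_zagreb_tail P T hT _ _ k0_big k0k.
  set X := standardize _ _ in tail *.
  have mX A : measurable A -> measurable (X @^-1` A)%classic.
    move=> mA; rewrite -[X in measurable X]setTI.
    exact: (@measurable_standardize _ _ _ P (zagreb_rv P (T k.+2))).
  have mtail : measurable [set w | (k0.+1%:R / 70 <= X w)%R]%classic.
    by have := mX _ (measurable_itv `[k0.+1%:R / 70, +oo[); rewrite set_itvE.
  apply: (@le_trans _ _ (P (~` [set w | (k0.+1%:R / 70 <= X w)%R])%classic)).
    rewrite /cdf /distribution /pushforward; apply: le_measure; rewrite ?inE.
    - exact: mX.
    - exact: measurableC.
    move=> w /=; rewrite in_itv /= => Xx; apply/negP; rewrite -ltNge.
    apply: le_lt_trans Xx _; rewrite /x ltr_pM2l // ltf_pV2 ?posrE //; lra.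
  rewrite probability_setC // EFinB; exact: leeB.
have := normal_prob_upper_tail m s s0 200 x; rewrite -normalY // => /(_ (ler0n _ _)).
rewrite -/(ccdf Y x) => ccdf_le; have := cdf_ccdf_1 Y x.
move: cdf_le ccdf_le.
rewrite -(@fineK _ (cdf Y x)) ?fin_num_measure //.
rewrite -(@fineK _ (ccdf Y x)) ?fin_num_measure //.
rewrite -EFinD !lee_fin => cdf_le ccdf_le [cdf_ccdf].
rewrite mulrC (_ : 2 * k0.+1%:R = 200 * x); last by rewrite /x; field.
apply: le_trans ccdf_le; move: cdf_le cdf_ccdf.
by move: (fine _) (fine _) (2 ^- _) => a b e; lra.
Unshelve. all: by end_near. Qed.
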